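(* Let $(G,f)$ be a SED-pair of order $n$, with $G=(V,E)$. Let $E_+ = \{e \in E : f(e)=1\}$, $E_- = \{e\in E : f(e) = -1\}$, and for each vertex $v$ let $s_v = \sum_{e \ni v} f(e)$ (sum over edges containing $v$). Let $V_+ = \{v \in V : s_v \geq 0\}$ and $V_- = \{v\in V : s_v < 0\}$. Suppose that every edge of $E_-$ joins a vertex of $V_+$ with a vertex of $V_-$, and every edge of $E_+$ joins two vertices of $V_+$. Then \[ s[(G,f)] \geq -\frac{1}{54}n^2. \]
   Context: All graphs are finite, simple and undirected. For an edge $e=(u,v)$ of $G$, its closed edge-neighborhood $N[e]$ is the set consisting of $e$ and all edges of $G$ sharing an endpoint with $e$. A function $f: E \to \{+1,-1\}$ is a signed edge domination function of $G=(V,E)$ if $\sum_{e' \in N[e]} f(e') \geq 1$ for every $e \in E$; in this case $(G,f)$ is called a SED-pair of order $|V|$. For such a pair, $s[(G,f)] = \sum_{e\in E} f(e)$. *)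

(* Defs.v *)
From mathcomp Require Import all_boot all_order all_algebra.
Set Implicit Arguments.
Unset Strict Implicit.
Unset Printing Implicit Defensive.
Import Order.TTheory GRing.Theory Num.Theory.
Local Open Scope ring_scope.

Record sgraph (V : finType) := SGraph {
  adj :> rel V;
  adj_sym : symmetric adj;
  adj_irr : irreflexive adj
}.

Section SignedEdgeDomination.
Variables (V : finType) (G : sgraph V).

Definition edges : {set {set V}} :=
  [set e : {set V} | [exists u, exists v, adj G u v && (e == [set u; v])]].

Definition closed_edge_nbhd (e : {set V}) : {set {set V}} :=
  e |: [set e' in edges | e :&: e' != set0].

(* An edge function is a total function on {set V}; only its values on
   edges G are ever constrained or summed. *)
Variable f : {set V} -> int.

Definition SED_pair : Prop :=
  (forall e, e \in edges -> f e = 1 \/ f e = -1) /\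
  (forall e, e \in edges -> 1 <= \sum_(e' in closed_edge_nbhd e) f e').

Definition SED_sum : int := \sum_(e in edges) f e.

Definition Eplus : {set {set V}} := [set e in edges | f e == 1].
Definition Eminus : {set {set V}} := [set e in edges | f e == -1].

Definition vsum (v : V) : int := \sum_(e in edges | v \in e) f e.

Definition Vplus : {set V} := [set v | 0 <= vsum v].
Definition Vminus : {set V} := [set v | vsum v < 0].

End SignedEdgeDomination.

(* Main.v *)
(** Let p_u and q_u be the numbers of positive and negative edges at u, so that
    s_u = p_u - q_u, and put S = sum of the positive s_u, D = sum_u p_u.
    A vertex v with s_v < 0 has only negative edges, hence degree -s_v, and
    domination along a negative edge uv reads s_u >= -s_v; so each such v adds
    at most 1 to sum_u q_u / s_u over the u with s_u > 0, whence
    sum_u p_u / s_u <= n. Writing 1 = (1/s_u) (1/s_v) (s_u s_v) on each positive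
    edge uv, Hoelder's inequality over ordered positive edges gives
    D^3 <= n * n * S^2, and by AM-GM this is at most (2S + n^2/27)^3. Finally
    every negative edge joins vertices of opposite signs, so the s_u add up to
    2S - D; that sum is twice the sum of f. *)
Require Import Defs.
From mathcomp Require Import all_boot all_order all_algebra.
From mathcomp Require Import ring lra.
Set Implicit Arguments.
Unset Strict Implicit.
Unset Printing Implicit Defensive.
Import Order.TTheory GRing.Theory Num.Theory.
Local Open Scope ring_scope.

Lemma exists_le_average (R : realDomainType) (I : finType) (A : {pred I})
    (F : I -> R) (c : R) :
    (0 < #|A|)%N -> \sum_(i in A) F i <= c *+ #|A| ->
  exists2 i, i \in A & F i <= c.
Proof.
move=> /card_gt0P[i0 Ai0]; rewrite -sumr_const => sumF; apply/exists_inP.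
apply: contraTT sumF; rewrite negb_exists_in -ltNge => /forall_inP F_gt.
apply: ltr_sum => [|i Ai]; last by rewrite ltNge F_gt.
by apply/hasP; exists i0; rewrite ?mem_index_enum.
Qed.

Lemma card_hoelder (R : realFieldType) (I J : finType) (A : {pred I})
    (F : J -> I -> R) :
    (forall j, {in A, forall i, 0 < F j i}) ->
    {in A, forall i, 1 <= \prod_j F j i} ->
  #|A|%:R ^+ #|J| <= \prod_j \sum_(i in A) F j i.
Proof.
move=> F_gt0 prodF_ge1.
have [A0|A_gt0] := posnP #|A|.
  rewrite A0 -prodr_const; apply: ler_prod => j _.
  by rewrite lexx sumr_ge0 // => i Ai; rewrite ltW ?F_gt0.
pose X j := \sum_(i in A) F j i; rewrite -[leRHS]/(\prod_j X j).
have X_gt0 j : 0 < X j.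
  have /card_gt0P[i Ai] := A_gt0.
  rewrite /X (bigD1 i) //= ltr_pwDl ?F_gt0 // sumr_ge0 // => k /andP[Ak _].
  by rewrite ltW ?F_gt0.
pose G i j := F j i * (#|A|%:R / X j).
have sumG : \sum_(i in A) \sum_j G i j <= #|J|%:R *+ #|A|.
  rewrite exchange_big /= (eq_bigr (fun=> #|A|%:R)) => [|j _].
    by rewrite sumr_const -!mulrnA mulnC.
  by rewrite -mulr_suml -/(X j) mulrCA divff ?mulr1 // gt_eqF.
(* By AM-GM, [\prod_j G i j <= 1] where [\sum_j G i j] is at most average. *)
have [i Ai sumGi] := exists_le_average A_gt0 sumG.
have G_ge0 : {in J, forall j, 0 <= G i j}.
  by move=> j _; rewrite mulr_ge0 ?divr_ge0 ?ler0n // ltW ?F_gt0.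
have prodG_le1 : \prod_j G i j <= 1.
  apply: le_trans (leif_AGM G_ge0) _.
  rewrite exprn_ile1 ?divr_ge0 ?sumr_ge0 //.
  by have [->|J_gt0] := posnP #|J|;
    rewrite ?invr0 ?mulr0 // ler_pdivrMr ?ltr0n // mul1r.
have -> : #|A|%:R ^+ #|J| = \prod_(j : J) #|A|%:R :> R by rewrite prodr_const.
rewrite -[leRHS]mul1r -ler_pdivrMr ?prodr_gt0 // -prodf_div.
apply: le_trans prodG_le1; rewrite [leRHS]big_split /= ler_peMl ?prodF_ge1 //.
by rewrite prodr_ge0 // => j _; rewrite divr_ge0 // ltW.
Qed.

Lemma AGM_sqr_mul (R : realDomainType) (a b : R) :
  0 <= a -> 0 <= b -> 27 * (a ^+ 2 * b) <= (2 * a + b) ^+ 3.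
Proof.
move=> a_ge0 b_ge0; rewrite -subr_ge0.
have -> : (2 * a + b) ^+ 3 - 27 * (a ^+ 2 * b) = (a - b) ^+ 2 * (8 * a + b).
  by ring.
by rewrite mulr_ge0 ?sqr_ge0 ?addr_ge0 ?mulr_ge0.
Qed.

Section DegreeSum.
Variables (R : realFieldType) (T : finType) (E : rel T).

Lemma sum_pairs_fst (F : T -> R) :
  \sum_(p : T * T | E p.1 p.2) F p.1 = \sum_u #|E u|%:R * F u.
Proof.
rewrite -(pair_big_dep xpredT E (fun u _ => F u)); apply: eq_bigr => u _.
by rewrite sumr_const mulr_natl.
Qed.

Lemma sum_pairs_snd (F : T -> R) : symmetric E ->
  \sum_(p : T * T | E p.1 p.2) F p.2 = \sum_u #|E u|%:R * F u.
Proof.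
move=> E_sym; rewrite -sum_pairs_fst (reindex (fun p => (p.2, p.1))) /=.
  by apply: eq_bigl => p; rewrite E_sym.
by exists (fun p => (p.2, p.1)) => -[].
Qed.

Variable x : T -> R.
Hypotheses (E_sym : symmetric E) (E_gt0 : forall u v, E u v -> 0 < x u).

Lemma degree_sum_hoelder :
  (\sum_u #|E u|%:R) ^+ 3
    <= (\sum_u #|E u|%:R / x u) ^+ 2 * (\sum_(u | 0 < x u) x u) ^+ 2.
Proof.
pose A := [pred p | E p.1 p.2].
pose F (j : 'I_3) p := nth 0 [:: (x p.1)^-1; (x p.2)^-1; x p.1 * x p.2] j.
have x_gt0 p : p \in A -> 0 < x p.1 /\ 0 < x p.2.
  rewrite inE => Ep; split; first exact: E_gt0 Ep.
  by apply: (E_gt0 (v := p.1)); rewrite E_sym.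
have card_A : #|A|%:R = \sum_u #|E u|%:R :> R.
  rewrite -sum1_card natr_sum (sum_pairs_fst (fun=> 1)).
  by apply: eq_bigr => u _; rewrite mulr1.
have F_gt0 j : {in A, forall p, 0 < F j p}.
  move=> p /x_gt0[xp1 xp2]; case: j => [[|[|[|//]]] ?];
  by rewrite /F /= ?invr_gt0 ?mulr_gt0.
have prodF p : p \in A -> 1 <= \prod_j F j p.
  move=> /x_gt0[xp1 xp2]; rewrite !big_ord_recl big_ord0 /F /= mulr1.
  by rewrite mulrA -invfM mulVf // gt_eqF ?mulr_gt0.
have := card_hoelder F_gt0 prodF.
rewrite card_ord card_A !big_ord_recl big_ord0 /F /= mulr1 mulrA.
pose xV u := (x u)^-1; rewrite (sum_pairs_fst xV) (sum_pairs_snd xV) //.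
move/le_trans; apply; rewrite -expr2 ler_wpM2l ?sqr_ge0 // expr2 big_distrlr /=.
rewrite pair_big /= [leLHS]big_mkcond [leRHS]big_mkcond /=.
apply: ler_sum => p _; case: ifPn => [/x_gt0[-> ->] //|_].
by case: ifP => // /andP[xp1 xp2]; rewrite mulr_ge0 ?ltW.
Qed.

Lemma degree_sum_le (n : R) : \sum_u #|E u|%:R / x u <= n ->
  \sum_u #|E u|%:R <= 2 * \sum_(u | 0 < x u) x u + n ^+ 2 / 27.
Proof.
move=> reciprocals_le.
set S := \sum_(u | 0 < x u) x u.
have S_ge0 : 0 <= S by apply: sumr_ge0 => u /ltW.
have n2_ge0 : 0 <= n ^+ 2 / 27 by rewrite divr_ge0 ?sqr_ge0.
have reciprocals_ge0 : 0 <= \sum_u #|E u|%:R / x u.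
  rewrite -(sum_pairs_fst (fun u => (x u)^-1)); apply: sumr_ge0 => p /E_gt0.
  by rewrite invr_ge0; apply: ltW.
have n_ge0 : 0 <= n by apply: le_trans reciprocals_le.
rewrite -(ler_pXn2r (n := 3)) ?nnegrE ?sumr_ge0 // ?addr_ge0 // ?mulr_ge0 //.
apply: le_trans degree_sum_hoelder _.
apply: le_trans (AGM_sqr_mul S_ge0 n2_ge0).
have -> : 27 * (S ^+ 2 * (n ^+ 2 / 27)) = n ^+ 2 * S ^+ 2 by field.
by rewrite ler_wpM2r ?sqr_ge0 // lerXn2r ?nnegrE.
Qed.

End DegreeSum.

Section SignedDegree.
Variables (R : realFieldType) (T : finType) (pos neg : rel T).

Definition signed_degree (u : T) : R := #|pos u|%:R - #|neg u|%:R.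

Local Notation s := signed_degree.

Hypotheses (pos_sym : symmetric pos) (neg_sym : symmetric neg).
Hypothesis pos_ge0 : forall u v, pos u v -> 0 <= s u.
Hypothesis neg_opposite : forall u v, neg u v -> (0 <= s u) = (s v < 0).
Hypothesis neg_sum_ge0 : forall u v, neg u v -> 0 <= s u + s v.

Lemma neg_signed_degree_gt0 u v : neg u v -> (0 < s u) = (s v < 0).
Proof.
move=> neg_uv; apply/idP/idP => [su|sv].
  by rewrite -(neg_opposite neg_uv) ltW.
by have := neg_sum_ge0 neg_uv; lra.
Qed.

Lemma pos_signed_degree_gt0 u v : pos u v -> 0 < s u.
Proof.
move=> pos_uv; have [w neg_uw|neg0] := pickP (neg u).
  by rewrite (neg_signed_degree_gt0 neg_uw)
    -(neg_opposite neg_uw) (pos_ge0 pos_uv).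
rewrite /s (eq_card0 neg0) subr0 ltr0n; apply/card_gt0P.
by exists v.
Qed.

Lemma card_pos_eq0 u : s u <= 0 -> #|pos u| = 0%N.
Proof.
move=> su; apply: eq_card0 => v; apply/negP => /pos_signed_degree_gt0.
by rewrite ltNge su.
Qed.

Lemma card_neg_signed_degree u : s u < 0 -> #|neg u|%:R = - s u.
Proof. by move=> su; rewrite /s (card_pos_eq0 (ltW su)) sub0r opprK. Qed.

Lemma exchange_sum_neg (F : T -> T -> R) :
  \sum_(u | 0 < s u) \sum_(v | neg u v) F u v
    = \sum_(v | s v < 0) \sum_(u | neg v u) F u v.
Proof.
rewrite (exchange_big_dep (fun v => s v < 0)) /= => [|u v su neg_uv].
  apply: eq_bigr => v sv; apply: eq_bigl => u; rewrite neg_sym.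
  by apply: andb_idl; rewrite neg_sym => /neg_signed_degree_gt0 ->.
by rewrite -(neg_signed_degree_gt0 neg_uv).
Qed.

Lemma sum_signed_degree :
  \sum_u s u = 2 * \sum_(u | 0 < s u) s u - \sum_u #|pos u|%:R.
Proof.
have sum_pos : \sum_u #|pos u|%:R = \sum_(u | 0 < s u) #|pos u|%:R :> R.
  rewrite [RHS]big_mkcond; apply: eq_bigr => u _.
  by case: ltP => // /card_pos_eq0 ->.
have sum_neg : \sum_(u | s u < 0) s u = - \sum_(u | 0 < s u) #|neg u|%:R.
  under [in RHS]eq_bigr do rewrite -sumr_const.
  rewrite exchange_sum_neg -sumrN; apply: eq_bigr => u su.
  by rewrite sumr_const card_neg_signed_degree ?opprK.
have -> : \sum_u s u = \sum_(u | 0 < s u) s u + \sum_(u | s u < 0) s u.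
  rewrite [X in _ = X + _]big_mkcond [X in _ = _ + X]big_mkcond -big_split /=.
  by apply: eq_bigr => u _; case: ltgtP; rewrite ?addr0 ?add0r.
by rewrite sum_pos sum_neg [X in X - _ = _]sumrB [X in 2 * X]sumrB; ring.
Qed.

Lemma sum_pos_degree_ratio_le : \sum_u #|pos u|%:R / s u <= #|T|%:R.
Proof.
have ratioE : \sum_u #|pos u|%:R / s u
    = \sum_(u | 0 < s u) (1 + \sum_(v | neg u v) (s u)^-1).
  rewrite [RHS]big_mkcond; apply: eq_bigr => u _.
  case: ltP => [su|/card_pos_eq0 ->]; last by rewrite mul0r.
  rewrite sumr_const -[_^-1 *+ _]mulr_natl.
  by rewrite -[X in X + _](divff (lt0r_neq0 su)) -mulrDl subrK.
have neg_ratio_le1 v : s v < 0 -> \sum_(u | neg v u) (s u)^-1 <= 1.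
  move=> sv; apply: le_trans (_ : \sum_(u | neg v u) (- s v)^-1 <= 1).
    apply: ler_sum => u neg_vu; have := neg_sum_ge0 neg_vu => suv_ge0.
    by rewrite lef_pV2 ?posrE ?oppr_gt0 //; lra.
  rewrite sumr_const -[_^-1 *+ _]mulr_natl card_neg_signed_degree //.
  by rewrite divff // oppr_eq0 lt_eqF.
rewrite ratioE big_split /= exchange_sum_neg.
have sum1E (C : pred T) : \sum_(u | C u) 1 = #|C|%:R :> R by rewrite sumr_const.
apply: le_trans (lerD (lexx _) (ler_sum _ neg_ratio_le1)) _.
rewrite !sum1E -natrD ler_nat -cardUI [X in (_ + X)%N]eq_card0.
  by rewrite addn0 max_card.
by move=> u; apply/negP => /andP[/lt_trans su /su]; rewrite ltxx.
Qed.

Lemma sum_signed_degree_ge : - (#|T|%:R ^+ 2 / 27) <= \sum_u s u.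
Proof.
rewrite sum_signed_degree.
have := degree_sum_le pos_sym pos_signed_degree_gt0 sum_pos_degree_ratio_le.
by lra.
Qed.

End SignedDegree.

Section TwoElementSets.
Variables (V : finType) (R : nmodType).

Lemma cards2_eq_set2 (e : {set V}) u v :
  #|e| = 2%N -> u \in e -> v \in e -> u != v -> e = [set u; v].
Proof.
move=> e2 ue ve uDv; apply/eqP.
rewrite eq_sym eqEcard cards2 uDv e2 leqnn andbT.
by apply/subsetP => x /set2P[] ->.
Qed.

Lemma set2_injr (u : V) : injective (fun v => [set u; v]).
Proof.
move=> v w eq_uv; have: v \in [set u; w] by rewrite -eq_uv set22.
have: w \in [set u; v] by rewrite eq_uv set22.
by move=> /set2P[-> | -> //] /set2P[].
Qed.

Variables (E : {set {set V}}) (F : {set V} -> R).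
Hypothesis E_card2 : {in E, forall e : {set V}, #|e| = 2%N}.

Lemma sum_incident u :
  \sum_(e in E | u \in e) F e = \sum_(v | [set u; v] \in E) F [set u; v].
Proof.
rewrite -(big_imset F (in2W (@set2_injr u))) /=; apply: eq_bigl => e.
apply/andP/imsetP => [[eE ue]|[v uvE ->]]; last by rewrite set21; split.
have /cards2P[x [y [_ e_xy]]] : #|e| == 2%N by rewrite E_card2.
have [v e_uv] : exists v, e = [set u; v].
  move: ue; rewrite e_xy => /set2P[] ->; first by exists y.
  by exists x; rewrite setUC.
by exists v; rewrite // unfold_in -e_uv.
Qed.

Lemma handshake :
  \sum_u \sum_(e in E | u \in e) F e = (\sum_(e in E) F e) *+ 2.
Proof.
under eq_bigr do rewrite big_mkcondr.
rewrite exchange_big -sumrMnl; apply: eq_bigr => e eE.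
by rewrite -big_mkcond sumr_const E_card2.
Qed.

End TwoElementSets.

Definition edge_rel (V : finType) (E : {set {set V}}) : rel V :=
  fun u v => [set u; v] \in E.

Lemma edge_rel_sym (V : finType) (E : {set {set V}}) : symmetric (edge_rel E).
Proof. by move=> u v; rewrite /edge_rel setUC. Qed.

Section EdgeFunctions.
Variables (V : finType) (G : sgraph V) (f : {set V} -> int).

Lemma card_edge : {in edges G, forall e : {set V}, #|e| = 2%N}.
Proof.
move=> e; rewrite inE => /existsP[u /existsP[v /andP[uv /eqP ->]]].
by rewrite cards2; have [eq_uv|//] := eqVneq u v; rewrite eq_uv adj_irr in uv.
Qed.

Lemma sum_vsum : \sum_u vsum G f u = SED_sum G f *+ 2.
Proof. exact: handshake card_edge. Qed.

Lemma in_closed_edge_nbhd u v e : [set u; v] \in edges G ->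
  (e \in closed_edge_nbhd G [set u; v])
    = (e \in edges G) && ((u \in e) || (v \in e)).
Proof.
move=> uvE; rewrite !in_setU in_set1 in_set; case: eqVneq => [->|_] /=.
  by rewrite uvE set21.
case: (e \in edges G) => //=; apply/set0Pn/orP => [[x]|[ue|ve]].
- by case/setIP=> /set2P[] ->; [left|right].
- by exists u; rewrite inE set21.
- by exists v; rewrite inE set22.
Qed.

Lemma sum_closed_edge_nbhd u v : [set u; v] \in edges G ->
  \sum_(e in closed_edge_nbhd G [set u; v]) f e
    = vsum G f u + vsum G f v - f [set u; v].
Proof.
move=> uvE; have uDv : u != v.
  by have := card_edge uvE; rewrite cards2; case: eqP.
have vsum_v : vsum G f v = f [set u; v]
    + \sum_(e in edges G | (v \in e) && (u \notin e)) f e.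
  rewrite /vsum (bigID (fun e : {set V} => u \in e)) /=; congr (_ + _).
    rewrite (big_pred1 [set u; v]) // => e /=.
    apply/andP/eqP => [[/andP[eE ve] ue]|->]; last by rewrite uvE set21 set22.
    exact: cards2_eq_set2 (card_edge eE) ue ve uDv.
  by apply: eq_bigl => e; rewrite andbA.
rewrite vsum_v addrA addrAC addrK.
rewrite (eq_bigl _ _ (fun e => in_closed_edge_nbhd e uvE)).
rewrite (bigID (fun e : {set V} => u \in e)) /=; congr (_ + _);
  apply: eq_bigl => e; rewrite -andbA; congr (_ && _);
  by case: (u \in e); case: (v \in e).
Qed.

Lemma dominated_Eminus_vsum_ge0 u v :
    {in edges G, forall e, 1 <= \sum_(e' in closed_edge_nbhd G e) f e'} ->
  edge_rel (Eminus G f) u v -> 0 <= vsum G f u + vsum G f v.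
Proof.
move=> dominated; rewrite /edge_rel inE => /andP[uvE /eqP f_uv].
by have := dominated _ uvE; rewrite sum_closed_edge_nbhd // f_uv opprK lerDr.
Qed.

Lemma edge_rel_vsum_ge0 (E : {set {set V}}) u v :
    {in E, forall e, exists x y,
      [/\ x \in Vplus G f, y \in Vplus G f & e = [set x; y]]} ->
  edge_rel E u v -> 0 <= vsum G f u.
Proof.
move=> E_Vplus /E_Vplus[x [y]]; rewrite !inE => -[sx sy eq_uv].
by have := set21 u v; rewrite eq_uv => /set2P[] ->.
Qed.

Lemma edge_rel_vsum_opposite (E : {set {set V}}) u v :
    {in E, forall e, exists x y,
      [/\ x \in Vplus G f, y \in Vminus G f & e = [set x; y]]} ->
  edge_rel E u v -> (0 <= vsum G f u) = (vsum G f v < 0).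
Proof.
move=> E_across /E_across[x [y]]; rewrite !inE => -[sx sy eq_uv].
have: u \in [set x; y] by rewrite -eq_uv set21.
case/set2P=> u_eq; move: eq_uv; rewrite u_eq => eq_uv.
  by rewrite (set2_injr eq_uv) sx sy.
rewrite [RHS]setUC in eq_uv.
by rewrite (set2_injr eq_uv) leNgt sy ltNge sx.
Qed.

Hypothesis f_pm1 : forall e, e \in edges G -> f e = 1 \/ f e = -1.

Lemma vsum_signed_degree (R : realFieldType) u :
  (vsum G f u)%:~R
    = signed_degree R (edge_rel (Eplus G f)) (edge_rel (Eminus G f)) u.
Proof.
have card_sum (A : pred V) : #|A|%:R = \sum_v (A v)%:R :> R.
  rewrite -sum1_card big_mkcond natr_sum; apply: eq_bigr => v _.
  by rewrite unfold_in; case: (A v).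
rewrite /vsum (sum_incident _ card_edge) rmorph_sum big_mkcond /=.
rewrite /signed_degree !card_sum -sumrB; apply: eq_bigr => v _.
rewrite /edge_rel [_ \in Eplus _ _]in_set [_ \in Eminus _ _]in_set.
case: ifP => [uvE|_]; last by rewrite subr0.
by case: (f_pm1 uvE) => ->; rewrite ?subr0 ?sub0r.
Qed.

End EdgeFunctions.

Theorem theorem3 (n : nat) (V : finType) (G : sgraph V) (f : {set V} -> int)
  (hn : #|V| = n) (hf : SED_pair G f)
  (hminus : forall e : {set V}, e \in Eminus G f ->
     exists u v : V, [/\ u \in Vplus G f, v \in Vminus G f & e = [set u; v]])
  (hplus : forall e : {set V}, e \in Eplus G f ->
     exists u v : V, [/\ u \in Vplus G f, v \in Vplus G f & e = [set u; v]]) :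
  - (1 / 54%:R) * n%:R ^+ 2 <= (SED_sum G f)%:~R :> rat.
Proof.
case: hf => f_pm1 dominated.
have sE u := esym (vsum_signed_degree f_pm1 rat u).
have : - (#|V|%:R ^+ 2 / 27) <= \sum_u (vsum G f u)%:~R :> rat.
  under eq_bigr do rewrite (vsum_signed_degree f_pm1).
  apply: sum_signed_degree_ge => u v; rewrite ?sE ?(ler0z, ltrz0).
  - exact: edge_rel_sym.
  - exact: edge_rel_sym.
  - exact: edge_rel_vsum_ge0 hplus.
  - exact: edge_rel_vsum_opposite hminus.
  - by rewrite -intrD ler0z; apply: dominated_Eminus_vsum_ge0.
by rewrite -rmorph_sum sum_vsum hn rmorphMn /=; lra.
Qed.
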